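(* Let $n\ge2$, let $-1\le\alpha<\beta\le1$ with $\beta^2\ge\alpha^2$, and let $B_{\alpha\beta}=\{x\in\mathbb{R}^n:\|x\|\le1,\ \alpha\le x_1\le\beta\}$. If $\alpha=-1$ and $\beta=1$, then the automorphism group of $B_{\alpha\beta}=B_n$ consists of the $n\times n$ orthogonal matrices. In the remaining cases, the automorphism group $\mathrm{Aut}(B_{\alpha\beta})$ consists of the linear transformations $T(u)=Au$ where $A$ is a matrix of the form $$A=\begin{bmatrix}a_{11}&0\\0&\bar A\end{bmatrix},\qquad a_{11}\in\mathbb{R},\ \bar A\in O_{n-1},$$ with $a_{11}=1$ if $\alpha\ne-\beta$ and $a_{11}=\pm1$ if $\alpha=-\beta$.
   Context: For a convex body $K\subset\mathbb{R}^n$ (compact convex set with nonempty interior), $\mathrm{Aut}(K)$ is the group of affine transformations $T(x)=a+Ax$ of $\mathbb{R}^n$ with $T(K)=K$. $O_m$ is the set of $m\times m$ orthogonal matrices, and $B_n$ is the closed Euclidean unit ball of $\mathbb{R}^n$. *)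

(* Defs.v *)
From mathcomp Require Import all_boot all_order all_algebra.
From mathcomp Require Import classical_sets reals.
Set Implicit Arguments.
Unset Strict Implicit.
Unset Printing Implicit Defensive.
Import Order.TTheory GRing.Theory Num.Theory.
Local Open Scope classical_set_scope.
Local Open Scope ring_scope.

(* Points of R^n are column vectors. The norm `|x| that MathComp-Analysis puts
   on matrices is the sup norm, hence a separate Euclidean norm. *)
Definition enorm (R : realType) (n : nat) (x : 'cV[R]_n) : R :=
  Num.sqrt (\sum_(i < n) x i 0 ^+ 2).

Definition eball (R : realType) (n : nat) : set 'cV[R]_n :=
  [set x | enorm x <= 1].
Arguments eball : clear implicits.

Definition orthogonal_mx (R : realType) (m : nat) : set 'M[R]_m :=
  [set A | A^T *m A = 1%:M].

Definition affine_map (R : realType) (n : nat) (T : 'cV[R]_n -> 'cV[R]_n) :=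
  exists (a : 'cV[R]_n) (A : 'M[R]_n), forall x, T x = a + A *m x.

(* T @` K = K forces T to be invertible when K has nonempty interior. *)
Definition Aut (R : realType) (n : nat) (K : set 'cV[R]_n) :
    set ('cV[R]_n -> 'cV[R]_n) :=
  [set T | affine_map T /\ T @` K = K].

(* The dimension is written 1 + m, so that a first coordinate exists and
   matrices split into blocks of sizes 1 and m;
   the first coordinate of x is x 0 0. *)
Definition ball_slab (R : realType) (m : nat) (alpha beta : R) :
    set 'cV[R]_(1 + m) :=
  [set x | enorm x <= 1 /\ alpha <= x 0 0 <= beta].
Arguments ball_slab {R} m alpha beta _.

(* Main.v *)
Require Import Defs.
From mathcomp Require Import all_boot all_order all_algebra.
From mathcomp Require Import classical_sets reals.
From mathcomp Require Import ring lra.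
Set Implicit Arguments.
Unset Strict Implicit.
Unset Printing Implicit Defensive.
Import Order.TTheory GRing.Theory Num.Theory.
Local Open Scope classical_set_scope.
Local Open Scope ring_scope.

(* An automorphism T(x) = a + Ax permutes the extreme points of K, which are the
   points of the unit sphere with first coordinate in [alpha, beta].  Hence the
   quadratic function |a + Ax|^2 - 1 vanishes on that zone of the sphere, which
   is large enough to force it to be proportional to |x|^2 - 1; so a = 0 and A
   is orthogonal.  If K is not the whole ball, w = A^T e1 is a unit vector such
   that <x, w> stays in [alpha, beta] on the zone; evaluating at suitable points
   of the plane spanned by e1 and w gives w = e1, or w = - e1 in the symmetric
   case, so A is block diagonal. *)

(** * Euclidean inner product, isometries and the unit ball *)

Section InnerProduct.
Variables (R : realType) (n : nat).
Implicit Types (x y z : 'cV[R]_n) (A : 'M[R]_n).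

Definition dot x y : R := \sum_(i < n) x i 0 * y i 0.

Lemma dotC x y : dot x y = dot y x.
Proof. by apply: eq_bigr => i _; rewrite mulrC. Qed.

Lemma dotDl x y z : dot (x + y) z = dot x z + dot y z.
Proof. by rewrite -big_split; apply: eq_bigr => i _; rewrite mxE mulrDl. Qed.

Lemma dotZl k x y : dot (k *: x) y = k * dot x y.
Proof. by rewrite mulr_sumr; apply: eq_bigr => i _; rewrite mxE mulrA. Qed.

Lemma dotNl x y : dot (- x) y = - dot x y.
Proof. by rewrite -scaleN1r dotZl mulN1r. Qed.

Lemma dotDr x y z : dot z (x + y) = dot z x + dot z y.
Proof. by rewrite dotC dotDl !(dotC z). Qed.

Lemma dotZr k x y : dot x (k *: y) = k * dot x y.
Proof. by rewrite dotC dotZl (dotC x). Qed.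

Lemma dotNr x y : dot x (- y) = - dot x y.
Proof. by rewrite dotC dotNl (dotC x). Qed.

Lemma dot0r x : dot x 0 = 0.
Proof. by rewrite -(scale0r x) dotZr mul0r. Qed.

Definition dot_bilin := (dotDl, dotDr, dotNl, dotNr, dotZl, dotZr).

Lemma dotE x y : dot x y = (x^T *m y) 0 0.
Proof. by rewrite mxE; apply: eq_bigr => i _; rewrite mxE. Qed.

Lemma dot_mulmxl A x y : dot (A *m x) y = dot x (A^T *m y).
Proof. by rewrite !dotE trmx_mul mulmxA. Qed.

Lemma dot_delta x i : dot x (delta_mx i 0) = x i 0.
Proof.
rewrite /dot (bigD1 i) //= big1 => [|j ne_ji].
  by rewrite mxE !eqxx mulr1 addr0.
by rewrite mxE (negbTE ne_ji) mulr0.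
Qed.

Lemma dot_ge0 x : 0 <= dot x x.
Proof. by apply: sumr_ge0 => i _; rewrite -expr2 sqr_ge0. Qed.

Lemma dot_eq0 x : dot x x = 0 -> x = 0.
Proof.
move=> /eqP; rewrite psumr_eq0 => [|i _]; last by rewrite -expr2 sqr_ge0.
move=> /allP x0; apply/matrixP => i j; rewrite (ord1 j) mxE.
by have := x0 i (mem_index_enum i); rewrite mulf_eq0 orbb => /eqP.
Qed.

Lemma enorm_le1 x : (enorm x <= 1) = (dot x x <= 1).
Proof. by rewrite -[X in _ <= X]sqrtr1 ler_sqrt ?ltr01. Qed.

Lemma sqr_coord_le x i : x i 0 ^+ 2 <= dot x x.
Proof.
rewrite /dot (bigD1 i) //= -expr2 lerDl.
by apply: sumr_ge0 => j _; rewrite -expr2 sqr_ge0.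
Qed.

Lemma coord_bounds x i : dot x x <= 1 -> -1 <= x i 0 <= 1.
Proof. by move=> /(le_trans (sqr_coord_le x i)) h; apply/andP; split; nra. Qed.

Lemma dot_orthogonal A x y : orthogonal_mx A -> dot (A *m x) (A *m y) = dot x y.
Proof. by move=> oA; rewrite dot_mulmxl mulmxA oA mul1mx. Qed.

Lemma orthogonal_of_dot A :
  (forall x, dot (A *m x) (A *m x) = dot x x) -> orthogonal_mx A.
Proof.
move=> hA; have polar x y : dot (A *m x) (A *m y) = dot x y.
  have := hA (x + y); rewrite mulmxDr !dot_bilin !hA.
  by rewrite (dotC (A *m y)) (dotC y); lra.
rewrite /orthogonal_mx /=; apply/matrixP => i j.
have := polar (delta_mx i 0) (delta_mx j 0).
rewrite dot_mulmxl mulmxA dotC dot_delta -colE mxE => ->.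
by rewrite dotC dot_delta !mxE eqxx andbT.
Qed.

(** For [|e| <= 1] the squared norm grows by at most [|e| * D]. The summand 1 makes [D] at least 1,
    so that the bound on [e] also forces [|e| <= 1]. *)
Lemma ball_room z v : dot z z < 1 -> exists2 e0 : R, 0 < e0 &
  forall e, `|e| <= e0 -> dot (z + e *: v) (z + e *: v) <= 1.
Proof.
move=> z1; set D := 1 + 2 * `|dot z v| + dot v v.
have hz := dot_ge0 z; have hv := dot_ge0 v; have hn := normr_ge0 (dot z v).
have D1 : 1 <= D by rewrite /D; lra.
have D0 : 0 < D by lra.
exists ((1 - dot z z) / D) => [|e]; first by apply: divr_gt0; lra.
rewrite ler_pdivlMr // => eD; have e0 := normr_ge0 e.
have e1 : `|e| <= 1 by nra.
have ez : e * dot z v <= `|e| * `|dot z v| by rewrite -normrM ler_norm.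
have ev : e * (e * dot v v) <= `|e| * dot v v.
  by rewrite mulrA -expr2 -real_normK ?num_real // ler_wpM2r //; nra.
by rewrite !dot_bilin !(dotC v z); move: eD; rewrite /D; lra.
Qed.

(** Parallelogram law: the squared length of [p - q] is at most 2 + 2 - 4 = 0. *)
Lemma sphere_extreme x p q : dot x x = 1 -> dot p p <= 1 -> dot q q <= 1 ->
  p + q = 2%:R *: x -> p = q.
Proof.
move=> x1 p1 q1 epq.
have s : dot (p + q) (p + q) = 4%:R by rewrite epq !dot_bilin x1; ring.
apply/eqP; rewrite -subr_eq0; apply/eqP/dot_eq0.
have d := dot_ge0 (p - q).
by move: s d; rewrite !dot_bilin (dotC q p); lra.
Qed.

End InnerProduct.

(** The left-hand side is |a + Ax|^2 at x = t e1 + s u: [a2], [P], [U] stand for the squared norms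
    of a, Ae1, Au, and [b1], [bu], [X] for the products <a, Ae1>, <a, Au>, <Ae1, Au>. Comparing s
    with -s separates the parts even and odd in s; each gives a polynomial in t that is constant on
    an interval. *)
Lemma zone_quadratic (R : realType) (alpha beta a2 b1 bu P U X : R) :
  -1 <= alpha -> alpha < beta -> beta <= 1 ->
  (forall t s, alpha <= t <= beta -> s ^+ 2 = 1 - t ^+ 2 ->
     a2 + t ^+ 2 * P + s ^+ 2 * U + 2 * t * b1 + 2 * s * bu
       + 2 * t * s * X = 1) ->
  [/\ U = P, X = 0, b1 = 0, bu = 0 & a2 + P = 1].
Proof.
move=> ha hab hb H.
have sqrtE t : alpha <= t <= beta -> Num.sqrt (1 - t ^+ 2) ^+ 2 = 1 - t ^+ 2.
  by move=> /andP[? ?]; rewrite sqr_sqrtr //; nra.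
have even t : alpha <= t <= beta ->
    a2 + t ^+ 2 * P + (1 - t ^+ 2) * U + 2 * t * b1 = 1.
  move=> ht; have sE := sqrtE t ht; have h1 := H t _ ht sE.
  have := H t (- Num.sqrt (1 - t ^+ 2)) ht; rewrite sqrrN => /(_ sE).
  by move: h1; rewrite sE; lra.
(* The strict bounds keep s nonzero, so that it can be cancelled. *)
have odd t : alpha < t < beta -> bu + t * X = 0.
  move=> /andP[lt_at lt_tb]; have ht : alpha <= t <= beta by rewrite !ltW.
  have sE := sqrtE t ht; have h1 := H t _ ht sE.
  have := H t (- Num.sqrt (1 - t ^+ 2)) ht; rewrite sqrrN => /(_ sE).
  move: h1; have : 0 < Num.sqrt (1 - t ^+ 2) by rewrite sqrtr_gt0; nra.
  by set s := Num.sqrt _ => s0 h1 h2; apply: (mulfI (lt0r_neq0 s0)); lra.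
(* The points [mu - h], [mu], [mu + h] lie strictly inside the interval. First differences isolate
   [X] and, once [U = P], also [b1]; the second difference isolates [U - P]. *)
pose mu := (alpha + beta) / 2; pose h := (beta - alpha) / 4.
have h0 : 0 < h by rewrite /h; lra.
have hm d : `|d| <= 1 -> alpha < mu + d * h < beta.
  by rewrite ler_norml => /andP[? ?]; rewrite /mu /h; apply/andP; split; nra.
have hm' d : `|d| <= 1 -> alpha <= mu + d * h <= beta.
  by move=> /hm /andP[? ?]; rewrite !ltW.
have n0 : `|0 : R| <= 1 by rewrite normr0.
have n1 : `|1 : R| <= 1 by rewrite normr1.
have nN : `|-1 : R| <= 1 by rewrite normrN1.
have h_neq0 := lt0r_neq0 h0.
have X0 : X = 0.
  apply: (mulfI h_neq0).
  by have := odd _ (hm _ n0); have := odd _ (hm _ n1); lra.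
have UP : U = P.
  apply: (mulfI (mulf_neq0 h_neq0 h_neq0)).
  have := even _ (hm' _ n0); have := even _ (hm' _ n1).
  by have := even _ (hm' _ nN); lra.
have b0 : b1 = 0.
  apply: (mulfI h_neq0); have := even _ (hm' _ n0); have := even _ (hm' _ n1).
  by rewrite UP; lra.
split=> //; first by have := odd _ (hm _ n0); rewrite X0; lra.
by have := even _ (hm' _ n0); rewrite UP b0; lra.
Qed.

(** * Interior and non-extreme points of the slab *)

Section Slab.
Variables (R : realType) (m : nat) (alpha beta : R).
Hypotheses (m_gt0 : (0 < m)%N).
Hypothesis bounds : [/\ -1 <= alpha, alpha < beta & beta <= 1].
Let K := ball_slab m alpha beta.
Let e1 : 'cV[R]_(1 + m) := delta_mx 0 0.

Let slabE x : K x <-> dot x x <= 1 /\ alpha <= dot x e1 <= beta.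
Proof. by rewrite /K /ball_slab /= enorm_le1 dot_delta. Qed.

Let dot_e1 : dot e1 e1 = 1.
Proof. by rewrite dot_delta mxE !eqxx. Qed.

Let tangent_exists : exists2 u : 'cV[R]_(1 + m), dot u u = 1 & dot u e1 = 0.
Proof.
exists (delta_mx (rshift 1 (Ordinal m_gt0)) 0).
  by rewrite dot_delta mxE !eqxx.
by rewrite dot_delta mxE.
Qed.

(** The point [mu *: e1] is interior to [K], so a small step [e *: r] from it stays in [K]. The step
    changes the form by [e * dot r r], which must therefore vanish. *)
Lemma slab_affine_span (r : 'cV[R]_(1 + m)) (k : R) :
  (forall x, K x -> dot x r = k) -> r = 0.
Proof.
have [alpha_ge alpha_lt_beta beta_le] := bounds.
move=> rk; pose mu := (alpha + beta) / 2; pose h := (beta - alpha) / 2.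
have h0 : 0 < h by rewrite /h; lra.
have mu1 : dot (mu *: e1) (mu *: e1) < 1.
  have [mu_gt mu_lt] : -1 < mu /\ mu < 1 by rewrite /mu; split; lra.
  by rewrite !dot_bilin dot_e1; nra.
have [d d0 hd] := ball_room r mu1.
(* Two limits on the step: [d] keeps the point in the ball, [h / D] keeps its first coordinate
   within [h] of [mu]. *)
pose D := 1 + `|dot r e1|; have D0 : 0 < D by rewrite ltr_wpDr.
pose e := Num.min d (h / D).
have e0 : 0 < e by rewrite lt_min d0 divr_gt0.
have Kz : K (mu *: e1).
  apply/slabE; split; first exact: ltW.
  by rewrite dotZl dot_e1 /mu; apply/andP; split; lra.
have Kr : K (mu *: e1 + e *: r).
  apply/slabE; split.
    by apply: hd; rewrite gtr0_norm // ge_min lexx.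
  have : `|e * dot r e1| <= h.
    rewrite normrM gtr0_norm //; apply: (@le_trans _ _ (e * D)).
      by rewrite ler_wpM2l ?(ltW e0) // lerDr.
    by rewrite -ler_pdivlMr // ge_min lexx orbT.
  rewrite ler_norml dotDl !dotZl dot_e1 /mu /h => /andP[? ?].
  by apply/andP; split; lra.
have := rk _ Kr; rewrite dotDl (rk _ Kz) dotZl => er.
by apply: dot_eq0; apply: (mulfI (lt0r_neq0 e0)); lra.
Qed.

(** A nonzero left kernel vector of [A] would give a nonzero linear form constant on [K]. *)
Lemma slab_affine_unit (a : 'cV[R]_(1 + m)) (A : 'M[R]_(1 + m)) :
  (forall y, K y -> exists x, y = a + A *m x) -> A \in unitmx.
Proof.
move=> onto; rewrite unitmxE unitfE; apply/negP => /det0P[v v0 vA].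
move/negP: v0; apply; rewrite -trmx_eq0; apply/eqP.
apply: (@slab_affine_span _ (dot a v^T)) => y /onto[x ->].
by rewrite dotDl dot_mulmxl -trmx_mul vA trmx0 dot0r addr0.
Qed.

(** A step orthogonal to [e1] preserves the first coordinate, so this covers points on the flat
    faces too. *)
Lemma slab_midpoint (y : 'cV[R]_(1 + m)) : K y -> dot y y < 1 ->
  exists v, [/\ v != 0, K (y + v) & K (y - v)].
Proof.
move=> /slabE[_ yK] y1; have [u u1 ue] := tangent_exists.
have [d d0 hd] := ball_room u y1; exists (d *: u); split.
- rewrite scaler_eq0 negb_or lt0r_neq0 //=; apply/eqP => u0.
  by move: u1; rewrite u0 dot0r; lra.
- apply/slabE; split; first by apply: hd; rewrite gtr0_norm.
  by rewrite dotDl dotZl ue mulr0 addr0.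
- apply/slabE; split; last by rewrite !dot_bilin ue mulr0 oppr0 addr0.
  by rewrite -scaleNr; apply: hd; rewrite normrN gtr0_norm.
Qed.

(** * Automorphisms are linear and orthogonal *)

Section Automorphism.
Variables (a : 'cV[R]_(1 + m)) (A : 'M[R]_(1 + m)).
Hypothesis TK : (fun x => a + A *m x) @` K = K.

Let into x : K x -> K (a + A *m x).
Proof. by move=> Kx; rewrite -TK; exists x. Qed.

Let onto y : K y -> exists2 x, K x & a + A *m x = y.
Proof. by rewrite -[X in X y -> _]TK => -[x]; exists x. Qed.

Lemma Aut_unit : A \in unitmx.
Proof. by apply: (@slab_affine_unit a) => y /onto[x _ <-]; exists x. Qed.

(** If the image of [x] were inside the open ball, it would be the midpoint of a nontrivial segment
    in [K]. The preimages of the endpoints would have midpoint [x], which is extreme in the ball. *)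
Lemma Aut_zone x : K x -> dot x x = 1 -> dot (a + A *m x) (a + A *m x) = 1.
Proof.
move=> Kx x1; have Ky := into Kx; have [y1 _] := (slabE _).1 Ky.
apply/eqP; rewrite eq_le y1 /= leNgt; apply/negP => y_lt1.
have [v [v0 /onto[p Kp ep] /onto[q Kq eqx]]] := slab_midpoint Ky y_lt1.
have : p = q.
  apply: (sphere_extreme x1 ((slabE _).1 Kp).1 ((slabE _).1 Kq).1).
  have : A *m (p + q) = A *m (2%:R *: x).
    have -> : A *m (p + q) = (a + A *m p) + (a + A *m q) - 2%:R *: a.
      rewrite mulmxDr; apply/matrixP => i j; rewrite !mxE; ring.
    by rewrite ep eqx -scalemxAr; apply/matrixP => i j; rewrite !mxE; ring.
  by move/(congr1 (mulmx (invmx A))); rewrite !(mulKmx Aut_unit).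
move=> pq; move: ep; rewrite pq eqx => /addrI vN.
move/negP: v0; apply; apply/eqP/matrixP => i j.
by move/matrixP/(_ i j): vN; rewrite !mxE; lra.
Qed.

Lemma Aut_orthogonal : a = 0 /\ orthogonal_mx A.
Proof.
have [alpha_ge alpha_lt_beta beta_le] := bounds.
(* Restrict to the unit circle in the plane of [e1] and [u], where t is the first coordinate. *)
have quad u : dot u u = 1 -> dot u e1 = 0 ->
    [/\ dot (A *m u) (A *m u) = dot (A *m e1) (A *m e1),
        dot (A *m e1) (A *m u) = 0, dot a (A *m e1) = 0,
        dot a (A *m u) = 0 & dot a a + dot (A *m e1) (A *m e1) = 1].
  move=> u1 ue; apply: (zone_quadratic alpha_ge alpha_lt_beta beta_le).
  move=> t s ht s2; pose x := t *: e1 + s *: u.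
  have x1 : dot x x = 1.
    by rewrite !dot_bilin u1 dot_e1 ue (dotC e1) ue; move: s2; lra.
  have Kx : K x.
    apply/slabE; split; first by rewrite x1.
    by rewrite !dot_bilin dot_e1 ue mulr1 mulr0 addr0.
  have := Aut_zone Kx x1; rewrite mulmxDr -!scalemxAr !dot_bilin.
  rewrite (dotC (A *m u) a) (dotC (A *m u) (A *m e1)) (dotC (A *m e1) a).
  by lra.
(* Homogeneity extends the identities to every [u] orthogonal to [e1]. *)
have quadZ u : dot u e1 = 0 ->
    [/\ dot (A *m u) (A *m u) = dot (A *m e1) (A *m e1) * dot u u,
        dot (A *m e1) (A *m u) = 0 & dot a (A *m u) = 0].
  have [->|u0] := eqVneq u 0; first by rewrite mulmx0 !dot0r mulr0.
  have ud : 0 < dot u u.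
    rewrite lt_def dot_ge0 andbT; apply: contra u0 => /eqP.
    by move/dot_eq0 => ->.
  pose l := Num.sqrt (dot u u).
  have l0 : l != 0 by rewrite sqrtr_eq0 -ltNge.
  have ll : l * l = dot u u by rewrite -expr2 sqr_sqrtr // ltW.
  have [w w1 ->] : exists2 w, dot w w = 1 & u = l *: w.
    exists (l^-1 *: u); last by rewrite scalerA mulfV // scale1r.
    by rewrite !dot_bilin -ll; field.
  move=> we.
  have we' : dot w e1 = 0.
    by apply: (mulfI l0); rewrite -dotZl we mulr0.
  have [hU hX _ hb _] := quad w w1 we'.
  by rewrite -scalemxAr !dot_bilin hU hX hb w1; split; ring.
have [u0 u01 u0e] := tangent_exists.
have [_ _ b1 _ aP] := quad u0 u01 u0e.
have split_x x : exists2 u, dot u e1 = 0 & x = dot x e1 *: e1 + u.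
  exists (x - dot x e1 *: e1); last by rewrite addrC subrK.
  by rewrite !dot_bilin dot_e1; ring.
(* The vector [a] is orthogonal to the range of [A], which contains [a] because [A] is
   invertible. *)
have a0 : a = 0.
  apply: dot_eq0; rewrite -{2}(mulKVmx Aut_unit a).
  have [u /quadZ[_ _ ub] ->] := split_x (invmx A *m a).
  by rewrite mulmxDr -scalemxAr !dot_bilin b1 ub mulr0 addr0.
split=> //; apply: orthogonal_of_dot => x; have [u ue ->] := split_x x.
have [hU hX _] := quadZ u ue.
move: aP; rewrite {1 2}a0 dot0r add0r => P1.
rewrite mulmxDr -scalemxAr !dot_bilin (dotC (A *m u)) hU hX P1 dot_e1 ue.
by rewrite (dotC e1) ue; ring.
Qed.

End Automorphism.

(** * The pulled-back axis when the slab is not the whole ball *)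

Section Axis.
Hypothesis alpha_bounds : -1 < alpha /\ - beta <= alpha.
Variable w : 'cV[R]_(1 + m).
Hypotheses (w1 : dot w w = 1).
Hypothesis zone_w : forall x, dot x x = 1 ->
  alpha <= dot x e1 <= beta -> alpha <= dot x w <= beta.

(** The part [v - c *: e1] of [v] orthogonal to [e1] has squared length 1 - c^2; [t] scales it so
    that adding [r *: e1] gives a unit vector, on the same side as [v]. *)
Let plane_point (c r : R) (v : 'cV[R]_(1 + m)) :
  dot v v = 1 -> dot v e1 = c -> c ^+ 2 < 1 -> r ^+ 2 <= 1 ->
  exists (x : 'cV[R]_(1 + m)) (t : R),
    [/\ dot x x = 1, dot x e1 = r, 0 <= t, t ^+ 2 * (1 - c ^+ 2) = 1 - r ^+ 2
      & dot x v = r * c + t * (1 - c ^+ 2)].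
Proof.
move=> v1 ve c1 r1; pose t := Num.sqrt ((1 - r ^+ 2) / (1 - c ^+ 2)).
have tE : t ^+ 2 * (1 - c ^+ 2) = 1 - r ^+ 2.
  rewrite sqr_sqrtr ?divfK ?gt_eqF //; first by lra.
  by apply: divr_ge0; lra.
exists (r *: e1 + t *: (v - c *: e1)), t; split=> //.
- rewrite !dot_bilin !(dotC e1 v) dot_e1 v1 ve; move: tE; lra.
- by rewrite !dot_bilin dot_e1 ve; ring.
- exact: sqrtr_ge0.
- by rewrite !dot_bilin (dotC e1) v1 ve; ring.
Qed.

(* With [r = cos p] and [c = cos q], [0 < q < p <= pi/2], the left-hand side is
   [cos (p - q)]. *)
Let cos_sub_gt (r c t : R) : 0 <= r -> r < c -> c ^+ 2 < 1 -> 0 <= t ->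
  t ^+ 2 * (1 - c ^+ 2) = 1 - r ^+ 2 -> r < r * c + t * (1 - c ^+ 2).
Proof.
move=> r0 rc c1 t0 tE.
have c_lt1 : c < 1 by nra.
have t1 : 1 <= t.
  rewrite leNgt; apply/negP => t_lt1.
  have : t ^+ 2 < 1 by nra.
  by nra.
have : 1 - c ^+ 2 <= t * (1 - c ^+ 2) by rewrite ler_peMl //; lra.
by nra.
Qed.

Lemma zone_axis : w = e1 \/ (alpha = - beta /\ w = - e1).
Proof.
have [alpha_ge alpha_lt_beta beta_le] := bounds.
have [alpha_gt alpha_beta] := alpha_bounds.
set c := dot w e1.
have beta_gt0 : 0 < beta by lra.
have c_le1 : c ^+ 2 <= 1 by rewrite /c dot_delta -w1 sqr_coord_le.
(* Otherwise [- w] lies in the zone, and its product with [w] is -1 < [alpha]. *)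
have Nw : ~ (alpha <= - c <= beta).
  move=> hc; have := @zone_w (- w); rewrite !dot_bilin w1 opprK.
  by move=> /(_ erefl hc) /andP[? _]; lra.
(* If c^2 < 1, each case below yields a zone point whose product with [w] is less than [alpha]. *)
have c2 : c ^+ 2 = 1.
  apply/eqP; rewrite eq_le c_le1 leNgt /=; apply/negP => c_lt1.
  (* For [alpha >= 0], take first coordinate [alpha] on the side of [- w]: the product is
     [alpha * c] minus a positive term. *)
  have [a_ge0|a_lt0] := lerP 0 alpha.
    have hr : alpha ^+ 2 <= 1 by nra.
    have [x [t [x1 xe t0 tE]]] := plane_point (v := - w) (c := - c) (r := alpha)
      ltac:(by rewrite !dot_bilin opprK) ltac:(by rewrite !dot_bilin)
      ltac:(by rewrite sqrrN) hr.
    rewrite dotNr sqrrN in tE *; move=> xw.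
    have := zone_w x1; rewrite xe lexx ltW // => /(_ isT) /andP[xw' _].
    have t_gt0 : 0 < t.
      rewrite lt_def t0 andbT; apply/eqP => tz.
      by move: tE; rewrite tz; nra.
    have : 0 < t * (1 - c ^+ 2) by apply: mulr_gt0 => //; lra.
    by nra.
  (* Here [- alpha < c]: the point [x] with first coordinate [- alpha] on the side of [w] has
     product above [- alpha], and [- x] is in the zone. *)
  have [Nc_lt|Nc_ge] := ltrP (- c) alpha.
    have hr : (- alpha) ^+ 2 <= 1 by nra.
    have [x [t [x1 xe t0 tE xw]]] := plane_point w1 (erefl c) c_lt1 hr.
    have := @zone_w (- x); rewrite !dot_bilin x1 xe !opprK lexx ltW //.
    move=> /(_ erefl isT) /andP[xw' _].
    have := cos_sub_gt _ _ c_lt1 t0 tE; rewrite -xw => /(_ _ _).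
    have r0 : 0 <= - alpha by lra.
    have rc : - alpha < c by lra.
    by move=> /(_ r0 rc); lra.
  (* In the remaining case the point with first coordinate [beta] on the side of [- w] has product
     with [w] below [- beta <= alpha]. *)
  have c_beta : beta < - c.
    by rewrite ltNge; apply/negP => ?; apply: Nw; rewrite Nc_ge.
  have hr : beta ^+ 2 <= 1 by nra.
  have Nc_lt1 : (- c) ^+ 2 < 1 by rewrite sqrrN.
  have [x [t [x1 xe t0 tE xw]]] := plane_point (v := - w)
      ltac:(by rewrite !dot_bilin opprK) (dotNl w e1) Nc_lt1 hr.
  have := zone_w x1; rewrite xe lexx ltW // => /(_ isT) /andP[xw' _].
  have := cos_sub_gt (ltW beta_gt0) c_beta Nc_lt1 t0 tE.
  by rewrite -xw dotNr; lra.
have wc : w = c *: e1.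
  apply/eqP; rewrite -subr_eq0; apply/eqP/dot_eq0.
  by rewrite !dot_bilin (dotC e1 w) dot_e1 w1 -/c; move: c2; lra.
have /eqP := c2; rewrite sqrf_eq1 => /orP[] /eqP cE.
  by left; rewrite wc cE scale1r.
right; split; last by rewrite wc cE scaleN1r.
(* A unit [y] with first coordinate [beta] now has product [- beta] with [w], so
   [alpha <= - beta]. *)
have [u u1 ue] := tangent_exists.
pose s := Num.sqrt (1 - beta ^+ 2).
have s2 : s ^+ 2 = 1 - beta ^+ 2 by rewrite sqr_sqrtr //; nra.
have [y y1 ye] : exists2 y, dot y y = 1 & dot y e1 = beta.
  exists (beta *: e1 + s *: u); rewrite !dot_bilin dot_e1 ue; last by ring.
  by rewrite (dotC e1) ue u1; move: s2; lra.
have := zone_w y1; rewrite ye lexx ltW // => /(_ isT) /andP[+ _].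
by rewrite wc cE dotZr ye; lra.
Qed.

End Axis.

End Slab.

(** * Orthogonal automorphisms and block diagonal form *)

Lemma orthogonal_image (R : realType) (n : nat) (K : set 'cV[R]_n)
    (A : 'M[R]_n) (T : 'cV[R]_n -> 'cV[R]_n) :
  orthogonal_mx A -> (forall u, T u = A *m u) ->
  (forall x, K x -> K (A *m x)) -> (forall x, K x -> K (A^T *m x)) -> Aut K T.
Proof.
move=> oA TE KA KAT; split; first by exists 0, A => x; rewrite add0r.
apply/seteqP; split=> [_ [x Kx <-]|y Ky]; first by rewrite TE; exact: KA.
exists (A^T *m y); first exact: KAT.
by rewrite TE mulmxA (mulmx1C oA) mul1mx.
Qed.

Lemma orthogonal_trmx (R : realType) (n : nat) (A : 'M[R]_n) :
  orthogonal_mx A -> orthogonal_mx A^T.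
Proof. by rewrite /orthogonal_mx /= trmxK => /mulmx1C. Qed.

(** The hypothesis fixes the first row of [A]. Applying [A] to it and scaling by [c] gives
    [A e1 = c e1], which fixes the first column. *)
Lemma block_of_axis (R : realType) (m : nat) (A : 'M[R]_(1 + m)) (c : R) :
  orthogonal_mx A -> c * c = 1 ->
  A^T *m delta_mx 0 0 = c *: (delta_mx 0 0 : 'cV_(1 + m)) ->
  orthogonal_mx (drsubmx A) /\ A = block_mx c%:M 0 0 (drsubmx A).
Proof.
move=> oA cc rowA.
have colA : A *m delta_mx 0 0 = c *: (delta_mx 0 0 : 'cV_(1 + m)).
  have /(congr1 (fun x => c *: (A *m x))) := rowA.
  by rewrite mulmxA (mulmx1C oA) mul1mx -scalemxAr scalerA cc scale1r => <-.
have blockA : A = block_mx c%:M 0 0 (drsubmx A).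
  rewrite -{1}[A]submxK; congr block_mx; apply/matrixP => i j.
  - have /matrixP/(_ 0 0) := colA.
    rewrite -colE !mxE !ord1 !eqxx mulr1 mulr1n => <-.
    by congr (A _ _); apply: val_inj.
  - have /matrixP/(_ (rshift 1 j) 0) := rowA.
    rewrite -colE !mxE ord1 /= mulr0 => <-.
    by congr (A _ _); apply: val_inj.
  - have /matrixP/(_ (rshift 1 i) 0) := colA.
    rewrite -colE !mxE ord1 /= mulr0 => <-.
    by congr (A _ _); apply: val_inj.
split=> //; move: oA; rewrite /orthogonal_mx /= {1 2}blockA tr_block_mx.
rewrite mulmx_block scalar_mx_block => /eq_block_mx[_ _ _].
by rewrite trmx0 mul0mx add0r.
Qed.

Lemma block_mx_coord0 (R : realType) (m : nat) (c : R) (B : 'M[R]_m)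
    (x : 'cV[R]_(1 + m)) :
  (block_mx (c%:M : 'M[R]_1) 0 0 B *m x) 0 0 = c * x 0 0.
Proof.
have -> : (0 : 'I_(1 + m)) = lshift m 0 by exact: val_inj.
rewrite -[x in LHS]vsubmxK mul_block_col mul0mx addr0 mul_scalar_mx.
by rewrite col_mxEu !mxE.
Qed.

Theorem lemma5p2 (R : realType) (m : nat) (alpha beta : R)
  (hn : (2 <= 1 + m)%N)
  (halpha : -1 <= alpha) (hab : alpha < beta) (hbeta : beta <= 1)
  (hsq : alpha ^+ 2 <= beta ^+ 2) :
  (alpha = -1 /\ beta = 1 ->
     ball_slab m alpha beta = eball R (1 + m) /\
     Aut (ball_slab m alpha beta) =
       [set T | exists2 A : 'M[R]_(1 + m),
                  orthogonal_mx A & forall u, T u = A *m u])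
  /\
  (~ (alpha = -1 /\ beta = 1) ->
     Aut (ball_slab m alpha beta) =
       [set T | exists (a11 : R) (Abar : 'M[R]_m),
          [/\ orthogonal_mx Abar,
              alpha <> - beta -> a11 = 1,
              alpha = - beta -> a11 = 1 \/ a11 = -1
            & forall u, T u = block_mx (a11%:M : 'M[R]_1) 0 0 Abar *m u]]).
Proof.
have m_gt0 : (0 < m)%N by [].
have bounds : [/\ -1 <= alpha, alpha < beta & beta <= 1] by [].
have AutE T : Aut (ball_slab m alpha beta) T ->
    exists2 A : 'M[R]_(1 + m), orthogonal_mx A & forall u, T u = A *m u.
  move=> [[a [A TE]] TK]; have [a0 oA] : a = 0 /\ orthogonal_mx A.
    apply: (Aut_orthogonal m_gt0 bounds); rewrite -[RHS]TK.
    by apply: eq_imagel => x _; rewrite TE.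
  by exists A => // u; rewrite TE a0 add0r.
split=> [[alphaE betaE]|not_ball].
  have slabE : ball_slab m alpha beta = eball R (1 + m).
    apply/seteqP; split=> x; first by case.
    rewrite /ball_slab /eball /= => x1.
    split=> //; rewrite alphaE betaE; apply: coord_bounds.
    by rewrite -enorm_le1.
  split=> //; apply/seteqP; split=> T; first exact: AutE.
  rewrite slabE => -[A oA TE]; apply: (orthogonal_image oA TE) => x.
    by rewrite /eball /= !enorm_le1 dot_orthogonal.
  by rewrite /eball /= !enorm_le1 (dot_orthogonal _ _ (orthogonal_trmx oA)).
(* Factor beta^2 - alpha^2 as (beta - alpha)(beta + alpha). *)
have alpha_beta : - beta <= alpha by nra.
(* If [alpha = -1], then [beta >= 1] and the slab is the whole ball. *)
have alpha_gt : -1 < alpha.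
  rewrite lt_def halpha andbT; apply/eqP => alphaE.
  by apply: not_ball; split=> //; lra.
apply/seteqP; split=> T.
  move=> autT; have [A oA TE] := AutE T autT.
  have [c [cc cE ax]] : exists c : R, [/\ c * c = 1,
      (alpha <> - beta -> c = 1) /\ (alpha = - beta -> c = 1 \/ c = -1)
    & A^T *m delta_mx 0 0 = c *: (delta_mx 0 0 : 'cV_(1 + m))].
    have : A^T *m delta_mx 0 0 = (delta_mx 0 0 : 'cV_(1 + m)) \/
        (alpha = - beta /\
         A^T *m delta_mx 0 0 = - (delta_mx 0 0 : 'cV_(1 + m))).
      apply: (zone_axis m_gt0 bounds) => // [|x x1 xK].
        by rewrite (dot_orthogonal _ _ (orthogonal_trmx oA)) dot_delta mxE.
      (* The product of [x] with [A^T e1] is the first coordinate of [T x], a point of the slab. *)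
      rewrite -dot_mulmxl -TE dot_delta.
      have : ball_slab m alpha beta (T x).
        rewrite -autT.2; exists x => //.
        by split; rewrite ?enorm_le1 ?x1 // -dot_delta.
      by case.
    case=> [ax|[sym ax]].
      by exists 1; rewrite mulr1 scale1r; split=> //; split=> // _; left.
    exists (-1); rewrite mulrNN mulr1 scaleN1r; split=> //.
    by split=> // _; right.
  have [oAbar AE] := block_of_axis oA cc ax.
  by exists c, (drsubmx A); split=> //; [exact: cE.1|exact: cE.2|rewrite -AE].
move=> [c [B [oB c1 cN TE]]].
have cc : c * c = 1.
  by have [/cN[] ->|/eqP/c1 ->] := eqVneq alpha (- beta); rewrite ?mulrNN mulr1.
have oA : orthogonal_mx (block_mx (c%:M : 'M[R]_1) 0 0 B).
  rewrite /orthogonal_mx /= tr_block_mx mulmx_block !trmx0 !mul0mx !mulmx0.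
  rewrite !addr0 add0r oB tr_scalar_mx -scalar_mxM cc.
  by rewrite -scalar_mx_block.
(* A general [D] serves both [B] and its transpose, the block of the inverse. *)
have slab_c (D : 'M[R]_m) x : orthogonal_mx (block_mx (c%:M : 'M[R]_1) 0 0 D) ->
    ball_slab m alpha beta x ->
    ball_slab m alpha beta (block_mx (c%:M : 'M[R]_1) 0 0 D *m x).
  move=> oD [x1 xK]; split.
    by rewrite enorm_le1 dot_orthogonal // -enorm_le1.
  rewrite block_mx_coord0.
  have [sym|/eqP/c1 ->] := eqVneq alpha (- beta); last by rewrite mul1r.
  by have [->|->] := cN sym; move: xK => /andP[? ?]; apply/andP; split; lra.
apply: (orthogonal_image oA TE) => x; first exact: slab_c.
rewrite tr_block_mx !trmx0 tr_scalar_mx; apply: slab_c.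
rewrite -[c%:M]tr_scalar_mx -[0]trmx0 -[X in block_mx _ _ X _]trmx0 -tr_block_mx.
exact: orthogonal_trmx.
Qed.
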